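(* $\mathrm{HPP} \leq_p \text{D-FSTOP}$, i.e., the Hamiltonian Path Problem (HPP) is polynomial-time reducible to the decision problem D-FSTOP.
   Context: STOP instance: a tuple $\langle G,S,P,s,t,p,d,M,T\rangle$ where $G=(N,A)$ is a (not necessarily complete) digraph with vertex set $N$ and arc set $A$; $s,t\in N$, $s\neq t$, are the origin and destination vertices; $S,P\subseteq N\setminus\{s,t\}$ are the sets of mandatory and profitable vertices, with $N=S\cup P\cup\{s,t\}$ and $S\cap P=\emptyset$; a reward $p_i\in\mathbb{Z}^+$ is associated with each $i\in P$; a traverse time $d_{ij}\in\mathbb{R}^+$ (non-negative) is associated with each arc $(i,j)\in A$; $M$ is a fleet of homogeneous vehicles, $m=|M|$; each vehicle can run for no more than a time limit $T$. A feasible solution of the instance is a collection of at most $m$ routes from $s$ to $t$ in $G$ (one for each vehicle used), each visiting no vertex more than once and having total traverse time at most $T$, such that every mandatory vertex (in $S$) belongs to exactly one route and every profitable vertex (in $P$) belongs to at most one route. D-FSTOP. Input: an STOP instance $\langle G,S,P,s,t,p,d,M,T\rangle$. Question: is there a feasible solution for the input STOP instance? HPP. Input: a digraph $G=(N,A)$, an origin vertex $s\in N$ and a destination vertex $t\in N$. Question: is there a Hamiltonian path from $s$ to $t$ in $G$ (a directed path from $s$ to $t$ visiting every vertex of $N$ exactly once)? *)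

(* Defs.v *)
From Stdlib Require Import BinNums.
From HB Require Import structures.
From mathcomp Require Import all_boot all_order all_algebra.
From mathcomp Require Import reals.

Set Implicit Arguments.
Unset Strict Implicit.
Unset Printing Implicit Defensive.

Import Order.TTheory GRing.Theory Num.Theory.

(* [TM A B] is a deterministic multi-tape Turing machine with input alphabet
   [A] and output alphabet [B].  Tapes are one-way infinite; there are
   [ntapes.+1] of them, the input being on tape [ord0] and the output on tape
   [ord_max].  A cell holds a symbol of [A], of [B] or of the auxiliary alphabet
   [aux], [None] being the blank.  All alphabets and the state set are finite,
   so [delta] is a finite transition table. *)

Inductive move := MoveLeft | Stay | MoveRight.

Definition tape_cell (A B X : finType) : finType := option (A + B + X)%type.

Record TM (A B : finType) := MkTM {
  state : finType;
  aux : finType;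
  ntapes : nat;
  start : state;
  halting : pred state;
  delta : state -> {ffun 'I_ntapes.+1 -> tape_cell A B aux} ->
          state * ('I_ntapes.+1 -> tape_cell A B aux * move)
}.

Section Run.

Variables (A B : finType) (M : TM A B).

Notation cell := (tape_cell A B (aux M)).

Record config := MkConfig {
  cstate : state M;
  chead : 'I_(ntapes M).+1 -> nat;
  ctape : 'I_(ntapes M).+1 -> nat -> cell
}.

Definition in_cell (a : A) : cell := Some (inl (inl a)).
Definition out_cell (b : B) : cell := Some (inl (inr b)).

Definition init (w : seq A) : config :=
  MkConfig (start M) (fun _ => 0)
    (fun i j => if i == ord0 then nth None (map in_cell w) j else None).

(* A left move from cell 0 leaves the head in place. *)
Definition move_head (h : nat) (m : move) : nat :=
  match m with MoveLeft => h.-1 | Stay => h | MoveRight => h.+1 end.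

(* Halting configurations are fixed points of [step]. *)
Definition step (c : config) : config :=
  if halting (cstate c) then c else
  let: (q, act) := delta (cstate c) [ffun i => ctape c i (chead c i)] in
  MkConfig q (fun i => move_head (chead c i) (act i).2)
    (fun i j => if j == chead c i then (act i).1 else ctape c i j).

Definition has_output (c : config) (u : seq B) : Prop :=
  forall j, ctape c ord_max j = nth None (map out_cell u) j.

Definition computes_in_time (f : seq A -> seq B) (t : nat -> nat) : Prop :=
  forall w, let c := iter (t (size w)) step (init w) in
    halting (cstate c) /\ has_output c (f w).

End Run.

Definition poly_time (A B : finType) (f : seq A -> seq B) : Prop :=
  exists (M : TM A B) (p : {poly nat}),
    computes_in_time M f (fun n => p.[n]%R).

Definition poly_reducible (A B : finType)
    (L1 : seq A -> Prop) (L2 : seq B -> Prop) : Prop :=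
  exists f : seq A -> seq B, poly_time f /\ forall w, L1 w <-> L2 (f w).

(* [r] is the sequence of all vertices of the path, both ends included. *)
Definition simple_path (N : finType) (arc : rel N) (x y : N) (r : seq N) : bool :=
  if r is z :: q then [&& z == x, path arc z q, last z q == y & uniq r]
  else false.

Record HPP_instance := MkHPP {
  hN : finType;
  harc : rel hN;
  hs : hN;
  ht : hN
}.

Definition has_hamiltonian_path (I : HPP_instance) : Prop :=
  exists r, simple_path (@harc I) (hs I) (ht I) r /\ forall v, v \in r.

(* [reward] and [time] are total functions for convenience; only their values
   on profitable vertices, respectively on arcs, are meaningful. *)
Record STOP_instance (R : realType) := MkSTOP {
  sN : finType;
  sarc : rel sN;
  mandatory : {set sN};
  profitable : {set sN};
  ss : sN;
  st : sN;
  reward : sN -> nat;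
  time : sN -> sN -> R;
  fleet : finType;
  limit : R;
  ss_neq_st : ss != st;
  mandatory_sub : mandatory \subset ~: [set ss; st];
  profitable_sub : profitable \subset ~: [set ss; st];
  vertices_cover : mandatory :|: profitable :|: [set ss; st] = [set: sN];
  mandatory_profitable_disjoint : mandatory :&: profitable = set0;
  reward_gt0 : forall i, i \in profitable -> 0 < reward i;
  time_ge0 : forall i j, sarc i j -> (0 <= time i j)%R;
  limit_ge0 : (0 <= limit)%R
}.

Section Feasibility.

Variables (R : realType) (I : STOP_instance R).

Definition route_time (r : seq (sN I)) : R :=
  (\sum_(a <- zip r (behead r)) time a.1 a.2)%R.

Definition is_route (r : seq (sN I)) : Prop :=
  simple_path (@sarc R I) (ss I) (st I) r /\ (route_time r <= limit I)%R.

(* Routes form a sequence, so that equal routes are counted separately. *)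
Definition feasible_solution (rs : seq (seq (sN I))) : Prop :=
  [/\ size rs <= #|fleet I|,
      forall r, r \in rs -> is_route r,
      forall v, v \in mandatory I -> count (fun r => v \in r) rs = 1 &
      forall v, v \in profitable I -> count (fun r => v \in r) rs <= 1].

Definition is_feasible : Prop := exists rs, feasible_solution rs.

End Feasibility.

Inductive symbol :=
  | Bit of bool | Slash
  | Row | NoArc | Arc
  | Origin | Destination | Mandatory | Profitable
  | Fleet | Limit.

Definition symbol_code (a : symbol) : bool + 'I_10 :=
  match a with
  | Bit b => inl b
  | Slash => inr (inord 0)
  | Row => inr (inord 1)
  | NoArc => inr (inord 2)
  | Arc => inr (inord 3)
  | Origin => inr (inord 4)
  | Destination => inr (inord 5)
  | Mandatory => inr (inord 6)
  | Profitable => inr (inord 7)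
  | Fleet => inr (inord 8)
  | Limit => inr (inord 9)
  end.

Definition symbol_decode (c : bool + 'I_10) : symbol :=
  match c with
  | inl b => Bit b
  | inr i => nth Slash [:: Slash; Row; NoArc; Arc; Origin; Destination;
                           Mandatory; Profitable; Fleet; Limit] i
  end.

Lemma symbol_codeK : cancel symbol_code symbol_decode.
Proof. by case=> [b||||||||||] //=; rewrite inordK. Qed.

HB.instance Definition _ := Finite.copy symbol (can_type symbol_codeK).

Definition word := seq symbol.

(* Binary numerals, most significant bit first. *)
Fixpoint pos_word (p : positive) : word :=
  match p with
  | xH => [:: Bit true]
  | xO q => rcons (pos_word q) (Bit false)
  | xI q => rcons (pos_word q) (Bit true)
  end.

Definition nat_word (n : nat) : word :=
  if bin_of_nat n is Npos p then pos_word p else [:: Bit false].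

(* Only used for nonnegative rationals, hence no sign. *)
Definition rat_word (q : rat) : word :=
  nat_word `|numq q|%N ++ Slash :: nat_word `|denq q|%N.

(* Adjacency matrix of a digraph, row by row, with a label [vlab v] on each
   vertex and a label [alab v u] on each arc. *)
Definition digraph_word (N : finType) (arc : rel N)
    (vlab : N -> word) (alab : N -> N -> word) : word :=
  flatten [seq Row :: vlab v ++
             flatten [seq if arc v u then Arc :: alab v u else [:: NoArc]
                     | u <- enum N]
          | v <- enum N].

Definition mark (b : bool) (w : word) : word := if b then w else [::].

Definition HPP_word (I : HPP_instance) : word :=
  digraph_word (@harc I)
    (fun v => mark (v == hs I) [:: Origin] ++ mark (v == ht I) [:: Destination])
    (fun _ _ => [::]).

(* Arbitrary reals have no finite encoding: the instances that can be written
   down as inputs are those whose traverse times and time limit are rational. *)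
Definition STOP_encodes (R : realType) (I : STOP_instance R) (w : word) : Prop :=
  exists (d : sN I -> sN I -> rat) (T : rat),
    [/\ forall i j, sarc i j -> time i j = ratr (d i j),
        limit I = ratr T &
        w = digraph_word (@sarc R I)
              (fun v => mark (v == ss I) [:: Origin] ++
                        mark (v == st I) [:: Destination] ++
                        mark (v \in mandatory I) [:: Mandatory] ++
                        mark (v \in profitable I)
                          (Profitable :: nat_word (reward v)))
              (fun i j => rat_word (d i j))
            ++ Fleet :: nat_word #|fleet I| ++ Limit :: rat_word T].

Definition HPP (w : word) : Prop :=
  exists I : HPP_instance, w = HPP_word I /\ has_hamiltonian_path I.

Definition D_FSTOP (R : realType) (w : word) : Prop :=
  exists I : STOP_instance R, STOP_encodes I w /\ is_feasible I.

(* Main.v *)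
(* Take [S] to be all vertices other than [s] and [t], [P] empty, one vehicle,
   null traverse times and [T = 0].  As soon as [S] is nonempty, a feasible
   solution is a single route through all vertices, i.e. a Hamiltonian path.
   On words this map is computed by a finite-state transducer, hence by a
   two-tape Turing machine in linear time: it needs no check that the input is
   the word of a digraph, because erasing the added symbols recovers the input,
   so that the image is the word of an instance only if the input is.  Graphs
   with at most two vertices, for which [S] may be empty although no Hamiltonian
   path exists, have words of length at most 10, which a finite table handles. *)

Require Import Defs.
From mathcomp Require Import all_boot all_order all_algebra.
From mathcomp Require Import boolp reals zify.

Set Implicit Arguments.
Unset Strict Implicit.
Unset Printing Implicit Defensive.

(** * Finite-state transducers and their two-tape machines *)

Section Transducer.

Variables (A B Q : finType) (next : Q -> A -> Q).
Variables (out : Q -> A -> seq B) (final : Q -> seq B).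

Fixpoint emit (q : Q) (w : seq A) : seq B :=
  if w is x :: w' then out q x ++ emit (next q x) w' else [::].

Definition transduce (q : Q) (w : seq A) : seq B :=
  emit q w ++ final (foldl next q w).

Lemma transduce_cons q x w :
  transduce q (x :: w) = out q x ++ transduce (next q x) w.
Proof. by rewrite /transduce /= catA. Qed.

Lemma emit_cat q w1 w2 :
  emit q (w1 ++ w2) = emit q w1 ++ emit (foldl next q w1) w2.
Proof. by elim: w1 q => //= x w1 IHw q; rewrite IHw catA. Qed.

Lemma transduce_cat q w1 w2 :
  transduce q (w1 ++ w2) = emit q w1 ++ transduce (foldl next q w1) w2.
Proof. by rewrite /transduce emit_cat foldl_cat catA. Qed.

Definition output_on (q : Q) (o : option A) : seq B :=
  if o is Some x then out q x else final q.

(** Bounds the write counter stored in the state, which keeps the state set finite. *)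
Definition output_bound : nat :=
  \max_(p : Q * option A) size (output_on p.1 p.2).

Lemma size_output_on q o : size (output_on q o) <= output_bound.
Proof. exact: (leq_bigmax (q, o)). Qed.

Definition scanned (c : tape_cell A B void) : option A :=
  if c is Some (inl (inl x)) then Some x else None.

(* In state [Some (q, k)] the first [k] letters of the word due for the scanned
   input letter (or for the end of the input) have been written. *)
Definition transducer_delta (s : option (Q * 'I_output_bound.+1))
    (c : {ffun 'I_2 -> tape_cell A B void}) :
    option (Q * 'I_output_bound.+1) * ('I_2 -> tape_cell A B void * move) :=
  if s is Some (q, k) then
    let o := scanned (c ord0) in
    if drop k (output_on q o) is y :: _ then
      (Some (q, inord k.+1),
       fun i => if i == ord0 then (c i, Stay)
                else (Some (inl (inr y)), MoveRight))
    else if o is Some x then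
      (Some (next q x, ord0),
       fun i => (c i, if i == ord0 then MoveRight else Stay))
    else (None, fun i => (c i, Stay))
  else (None, fun i => (c i, Stay)).

Definition transducer_TM (q0 : Q) : TM A B :=
  @MkTM A B _ void 1 (Some (q0, ord0)) (fun s => s == None) transducer_delta.

Section Correctness.

Variable q0 : Q.
Notation M := (transducer_TM q0).

(** Invariant of a run: the output head stands on the first blank after [u], so the next letter
    written is appended. *)
Record at_config (w : seq A) (s : state M) (h : nat) (u : seq B)
    (c : config M) : Prop := AtConfig {
  at_state : cstate c = s;
  at_input_head : chead c ord0 = h;
  at_output_head : chead c ord_max = size u;
  at_input : forall j, ctape c ord0 j = nth None (map (@in_cell A B M) w) j;
  at_output : has_output c u
}.

Lemma scanned_input w s h u c : at_config w s h u c ->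
  scanned (ctape c ord0 (chead c ord0)) = onth w h.
Proof.
case=> _ -> _ -> _.
by elim: w h => [|x w IHw] [|h] //=.
Qed.

Lemma step_emit w q (k : 'I_output_bound.+1) h u1 y u2 c :
    at_config w (Some (q, k)) h u1 c ->
    drop k (output_on q (onth w h)) = y :: u2 ->
  at_config w (Some (q, inord k.+1)) h (rcons u1 y) (step c).
Proof.
move=> Hc Hd; have Hs := scanned_input Hc; case: Hc => c1 c2 c3 c4 c5.
rewrite /step c1 /= ffunE Hs Hd; split=> //=.
- by rewrite c3 size_rcons.
- by move=> j; rewrite -c4 ffunE; case: eqP => [->|].
- move=> j /=; rewrite c3 map_rcons nth_rcons size_map.
  case: (ltngtP j (size u1)) => // Hj; rewrite c5 nth_default // size_map.
  exact: ltnW.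
Qed.

Lemma step_next w q (k : 'I_output_bound.+1) h u x c :
    at_config w (Some (q, k)) h u c ->
    onth w h = Some x -> drop k (output_on q (onth w h)) = [::] ->
  at_config w (Some (next q x, ord0)) h.+1 u (step c).
Proof.
move=> Hc Hx Hd; have Hs := scanned_input Hc; case: Hc => c1 c2 c3 c4 c5.
rewrite /step c1 /= ffunE Hs Hd Hx; split=> //=.
- by rewrite c2.
- by move=> j; rewrite -c4 ffunE; case: eqP => [->|].
- by move=> j /=; rewrite -c5 ffunE; case: eqP => [->|].
Qed.

Lemma step_halt w q (k : 'I_output_bound.+1) h u c :
    at_config w (Some (q, k)) h u c ->
    onth w h = None -> drop k (output_on q (onth w h)) = [::] ->
  at_config w None h u (step c).
Proof.
move=> Hc Hx Hd; have Hs := scanned_input Hc; case: Hc => c1 c2 c3 c4 c5.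
rewrite /step c1 /= ffunE Hs Hd Hx; split=> //=.
- by move=> j; rewrite -c4 ffunE; case: eqP => [->|].
- by move=> j /=; rewrite -c5 ffunE; case: eqP => [->|].
Qed.

Lemma run_emit w q h u2 (k : 'I_output_bound.+1) u1 c :
    at_config w (Some (q, k)) h u1 c ->
    drop k (output_on q (onth w h)) = u2 ->
  exists2 k' : 'I_output_bound.+1, drop k' (output_on q (onth w h)) = [::] &
    at_config w (Some (q, k')) h (u1 ++ u2) (iter (size u2) (@step A B M) c).
Proof.
elim: u2 k u1 c => [|y u2 IHu] k u1 c Hc Hd.
  by exists k; rewrite ?cats0.
(* A letter is still due, so [k] is below the length of the current output word and [inord k.+1]
   keeps its value. *)
have Hk : k.+1 < output_bound.+1.
  rewrite ltnS; apply: leq_trans (size_output_on q (onth w h)).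
  by rewrite ltnNge; apply: contra_eqN Hd => /drop_oversize->.
rewrite -cat_rcons [size _]/= iterSr; apply: IHu (step_emit Hc Hd) _.
by rewrite inordK // -addn1 addnC -drop_drop Hd /= drop0.
Qed.

(** Each letter of [w2], and likewise the end of the input, costs at most [output_bound] writing
    steps and one step to advance or halt. *)
Lemma run_transducer w1 w2 q u c :
    at_config (w1 ++ w2) (Some (q, ord0)) (size w1) u c ->
  exists2 m, m <= output_bound.+1 * (size w2).+1 &
    exists h, at_config (w1 ++ w2) None h (u ++ transduce q w2)
                (iter m (@step A B M) c).
Proof.
elim: w2 w1 q u c => [|x w2 IHw] w1 q u c Hc.
  have Hx : onth (w1 ++ [::]) (size w1) = None by rewrite onth_default ?cats0.
  have [k Hk Hc'] := run_emit Hc erefl.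
  exists (size (output_on q None)).+1; first by rewrite muln1 ltnS size_output_on.
  exists (size w1); rewrite iterS.
  by rewrite Hx drop0 in Hc'; apply: step_halt Hc' Hx Hk.
have Hx : onth (w1 ++ x :: w2) (size w1) = Some x.
  by rewrite onth_cat ltnn subnn.
have [k Hk Hc'] := run_emit Hc erefl.
have := step_next Hc' Hx Hk; rewrite Hx drop0 -iterS -cat_rcons -(size_rcons w1 x).
case/IHw => m Hm [h Hh]; exists (m + (size (output_on q (Some x))).+1).
  by rewrite mulnS addnC leq_add // ltnS size_output_on.
by exists h; rewrite iterD transduce_cons catA.
Qed.

End Correctness.

Lemma iter_step_halting (M : TM A B) (c : config M) m :
  halting (cstate c) -> iter m (@step A B M) c = c.
Proof. by move=> Hc; elim: m => //= m ->; rewrite /step Hc. Qed.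

Lemma transduce_poly_time q0 : poly_time (transduce q0).
Proof.
exists (transducer_TM q0), (output_bound.+1%:P * ('X + 1))%R => w /=.
have [|m Hm [h [h1 _ _ _ h5]]] :=
  @run_transducer q0 [::] w q0 [::] (init (transducer_TM q0) w).
  by split=> // j /=; rewrite !nth_nil.
have -> : (output_bound.+1%:P * ('X + 1) : {poly nat})%R.[size w]%R =
    output_bound.+1 * (size w).+1.
  rewrite hornerM hornerC hornerD hornerX hornerC; congr (_ * _); exact: addn1.
(* The machine may halt early; a halted configuration is fixed, so running on to the full bound
   changes nothing. *)
by rewrite -(subnK Hm) iterD iter_step_halting h1.
Qed.

End Transducer.

(** * Overriding a transducer by a table on short words *)

Section Patch.

Variables (A B Q : finType) (next : Q -> A -> Q).
Variables (out : Q -> A -> seq B) (final : Q -> seq B) (q0 : Q).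
Variables (L : nat) (table : seq A -> seq B).

(* As long as at most [L] letters have been read, they are remembered in the
   state and nothing is written. *)
Definition patch_next (s : L.-bseq A + Q) (x : A) : L.-bseq A + Q :=
  match s with
  | inl b => if insub (rcons b x) is Some b' then inl b'
             else inr (foldl next q0 (rcons b x))
  | inr q => inr (next q x)
  end.

(** The letter that overflows the memory releases at once all the output withheld so far. *)
Definition patch_out (s : L.-bseq A + Q) (x : A) : seq B :=
  match s with
  | inl b => if size b < L then [::] else emit next out q0 (rcons b x)
  | inr q => out q x
  end.

Definition patch_final (s : L.-bseq A + Q) : seq B :=
  match s with
  | inl b => table b
  | inr q => final q
  end.

Lemma patch_transduce_inr q w :
  transduce patch_next patch_out patch_final (inr q) w
  = transduce next out final q w.
Proof. by elim: w q => //= x w IHw q; rewrite !transduce_cons IHw. Qed.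

Lemma patch_transduce_inl (b : L.-bseq A) w :
  transduce patch_next patch_out patch_final (inl b) w
  = if size (b ++ w) <= L then table (b ++ w)
    else transduce next out final q0 (b ++ w).
Proof.
elim: w b => [|x w IHw] b; first by rewrite cats0 size_bseq.
rewrite transduce_cons /=; case: insubP => [b'|].
  rewrite size_rcons => Hb b'E; rewrite Hb IHw -cat_rcons /=.
  by rewrite b'E.
rewrite size_rcons => Hb; rewrite (negbTE Hb) patch_transduce_inr.
rewrite -cat_rcons -transduce_cat ifF //.
by apply/negbTE; apply: contra Hb; rewrite size_cat size_rcons; lia.
Qed.

Lemma patched_transduce_poly_time :
  poly_time (fun w =>
    if size w <= L then table w else transduce next out final q0 w).
Proof.
have [M [p Mp]] := transduce_poly_time patch_next patch_out patch_final
                     (inl [bseq]).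
exists M, p => w; have [? Hw] := Mp w; split=> //.
by move: Hw; rewrite patch_transduce_inl.
Qed.

End Patch.

(** * Words of numerals and digraphs *)

Lemma cat_cons_inj (T : eqType) (a : T) s1 s2 t1 t2 :
    a \notin s1 -> a \notin s2 -> s1 ++ a :: t1 = s2 ++ a :: t2 ->
  s1 = s2 /\ t1 = t2.
Proof.
move=> a1 a2 E.
have Es : size s1 = size s2.
  have := congr1 (index a) E.
  by rewrite !index_cat (negbTE a1) (negbTE a2) /= eqxx !addn0.
by move/eqP: E; rewrite eqseq_cat // eqseq_cons eqxx /= => /andP[/eqP-> /eqP->].
Qed.

Definition is_bit (a : symbol) : bool := if a is Bit _ then true else false.

Lemma all_nat_word n : all is_bit (nat_word n).
Proof.
rewrite /nat_word; case: bin_of_nat => //.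
by elim=> //= p IHp; rewrite all_rcons.
Qed.

Lemma nat_word_eq1 n : nat_word n = [:: Bit true] -> n = 1.
Proof.
rewrite /nat_word -{2}[n]bin_of_natK; case: bin_of_nat => //.
have pos_word_gt0 p : 0 < size (pos_word p).
  by case: p => //= p; rewrite size_rcons.
by case=> // p /= /(congr1 size) [] /eqP; rewrite size_rcons ?eqSS eqn0Ngt pos_word_gt0.
Qed.

Lemma all_mark P b w : all P w -> all P (mark b w).
Proof. by case: b. Qed.

Lemma filter_mark P b w : filter P (mark b w) = mark b (filter P w).
Proof. by case: b. Qed.

Lemma all_digraph_word (P : pred symbol) (N : finType) (arc : rel N) vlab alab :
    P Row -> P NoArc -> P Arc -> (forall v, all P (vlab v)) ->
    (forall v u, all P (alab v u)) ->
  all P (digraph_word arc vlab alab).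
Proof.
move=> P1 P2 P3 /= Pv Pa; apply/allP=> a /flatten_mapP[v _].
rewrite inE mem_cat => /or3P[/eqP->//|/(allP (Pv v))//|/flatten_mapP[u _]].
case: ifP => _; rewrite inE; last by move/eqP->.
by case/orP=> [/eqP->//|/(allP (Pa v u))].
Qed.

Lemma filter_digraph_word (P : pred symbol) (N : finType) (arc : rel N) vlab alab :
    P Row -> P NoArc -> P Arc ->
  filter P (digraph_word arc vlab alab)
  = digraph_word arc (fun v => filter P (vlab v)) (fun v u => filter P (alab v u)).
Proof.
move=> P1 P2 P3; rewrite /digraph_word filter_flatten -map_comp.
congr flatten; apply: eq_map => v /=; rewrite P1 filter_cat filter_flatten.
rewrite -map_comp; congr (_ :: _ ++ flatten _); apply: eq_map => u /=.
by case: ifP => /= _; rewrite ?P2 ?P3.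
Qed.

Lemma mem_digraph_word (N : finType) (arc : rel N) vlab alab a v :
  a \in vlab v -> a \in digraph_word arc vlab alab.
Proof.
move=> av; apply/flatten_mapP; exists v; first by rewrite mem_enum.
by rewrite inE mem_cat av orbT.
Qed.

Lemma eq_digraph_word (N : finType) (arc : rel N) vlab1 vlab2 alab1 alab2 :
    vlab1 =1 vlab2 -> alab1 =2 alab2 ->
  digraph_word arc vlab1 alab1 = digraph_word arc vlab2 alab2.
Proof.
move=> Ev Ea; rewrite /digraph_word; congr flatten; apply: eq_map => v.
rewrite Ev; congr (_ :: _ ++ flatten _); apply: eq_map => u.
by rewrite Ea.
Qed.

(** A row consists of [Row], at most two terminal marks and one symbol per vertex. *)
Lemma size_HPP_word I : size (HPP_word I) <= #|hN I| * (#|hN I| + 3).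
Proof.
rewrite cardE /HPP_word /digraph_word.
have size_row v : size (flatten [seq if harc v u then [:: Arc] else [:: NoArc]
    | u <- enum (hN I)]) = size (enum (hN I)).
  by elim: (enum _) => //= u s IHs; rewrite size_cat IHs; case: ifP.
(* The induction is on the list of rows only; the columns keep the full enumeration. *)
elim: {2 3}(enum _) => //= v s IHs; rewrite mulSn size_cat.
rewrite -addSn leq_add // !size_cat size_row addnC -addnS leq_add2l.
by do 2!case: eqP => _.
Qed.

(** * The reduction as a map on words *)

Section Reduction.

Definition is_row (x : symbol) : bool := if x is Row then true else false.

Definition is_hpp_symbol (x : symbol) : bool :=
  match x with
  | Row | NoArc | Arc | Origin | Destination => true
  | _ => false
  end.

Definition is_terminal (x : symbol) : bool :=
  match x with Origin | Destination => true | _ => false end.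

(* A symbol that occurs in no word of an HPP instance becomes a second [Limit],
   which occurs only once in the word of an STOP instance. *)
Definition symbol_image (x : symbol) : word :=
  if x is Arc then Arc :: rat_word 0
  else if is_hpp_symbol x then [:: x] else [:: Limit].

(* The state tells whether the last symbol read is [Row]. *)
Definition reduction_next (b : bool) (x : symbol) : bool := is_row x.

(** A vertex label starts right after [Row]: if no terminal mark stands there, the vertex is made
    mandatory. *)
Definition reduction_out (b : bool) (x : symbol) : word :=
  mark (b && ~~ is_terminal x) [:: Mandatory] ++ symbol_image x.

Definition reduction_final (b : bool) : word :=
  Fleet :: nat_word 1 ++ Limit :: rat_word 0.

Notation graph_image := (emit reduction_next reduction_out).
Notation reduction := (transduce reduction_next reduction_out reduction_final false).

Lemma all_graph_image (P : pred symbol) b w :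
    (forall x, is_hpp_symbol x -> P x) -> P Mandatory -> P Limit ->
    all P (rat_word 0) ->
  all P (graph_image b w).
Proof.
move=> Pi Pm Pl Pr; elim: w b => //= x w IHw b; rewrite !all_cat IHw andbT.
apply/andP; split; first by case: (b && _); rewrite /= ?Pm.
by case: x => *; first [exact/andP/(conj (Pi Arc _) Pr) | rewrite /= ?Pl ?Pi].
Qed.

Lemma graph_image_hpp_symbols b w :
  Limit \notin graph_image b w -> all is_hpp_symbol w.
Proof.
elim: w b => //= x w IHw b; rewrite !mem_cat !negb_or => /andP[/andP[_ xL]] /IHw->.
by case: x xL => //=; rewrite inE eqxx.
Qed.

(** The inserted symbols, namely [Mandatory], digits and [Slash], lie outside the alphabet of HPP
    words, so filtering undoes the insertion. *)
Lemma filter_graph_image b w :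
  all is_hpp_symbol w -> filter is_hpp_symbol (graph_image b w) = w.
Proof.
elim: w b => //= x w IHw b /andP[Hx Hw]; rewrite !filter_cat IHw //.
by case: b; case: x Hx.
Qed.

(** * From Hamiltonian paths to feasible solutions *)

Section Complete.

Variable I : HPP_instance.
Hypothesis neq_st : hs I != ht I.

Lemma graph_image_entries (v : hN I) s w :
  graph_image false (flatten [seq if harc v u then [:: Arc] else [:: NoArc]
                             | u <- s] ++ w)
  = flatten [seq if harc v u then Arc :: rat_word 0 else [:: NoArc] | u <- s]
    ++ graph_image false w.
Proof. by elim: s => //= u s IHs; case: ifP => _ /=; rewrite IHs. Qed.

Lemma graph_image_row (v : hN I) w :
  graph_image false
    (Row :: (mark (v == hs I) [:: Origin] ++ mark (v == ht I) [:: Destination])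
     ++ flatten [seq if harc v u then [:: Arc] else [:: NoArc] | u <- enum (hN I)]
     ++ w)
  = Row :: (mark (v == hs I) [:: Origin] ++ mark (v == ht I) [:: Destination] ++
            mark (v \in ~: [set hs I; ht I]) [:: Mandatory])
    ++ flatten [seq if harc v u then Arc :: rat_word 0 else [:: NoArc]
               | u <- enum (hN I)]
    ++ graph_image false w.
Proof.
rewrite /= !inE; case: eqP => [->|_] /=.
  by rewrite (negbTE neq_st) /= graph_image_entries.
case: eqP => _ /=; first by rewrite graph_image_entries.
(* For an unmarked vertex, [Mandatory] is triggered by the first matrix entry, which exists because
   [hs I] is a vertex. *)
have := mem_enum (hN I) (hs I); case: (enum _) => //= u s _.
by case: ifP => _ /=; rewrite graph_image_entries.
Qed.

Variable R : realType.

Definition STOP_of_HPP : STOP_instance R.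
Proof.
refine (@MkSTOP R (hN I) (@harc I) (~: [set hs I; ht I]) set0 (hs I) (ht I)
  (fun=> 1) (fun _ _ => 0%R) unit 0%R neq_st _ _ _ _ _ _ _) => //.
- exact: sub0set.
- by rewrite setU0 setUC setUCr.
- by rewrite setI0.
Defined.

Lemma STOP_of_HPP_encodes : STOP_encodes STOP_of_HPP (reduction (HPP_word I)).
Proof.
exists (fun _ _ => 0%R), 0%R; split=> [i j _||]; rewrite /= ?GRing.rmorph0 //.
rewrite /transduce /reduction_final card_unit; congr (_ ++ _).
rewrite /HPP_word /digraph_word /=.
elim: {2 4}(enum _) => // v s IHs.
rewrite [flatten _]/= -catA graph_image_row; congr (_ :: _).
by rewrite IHs in_set0 cats0 catA.
Qed.

Lemma STOP_of_HPP_feasible : has_hamiltonian_path I -> is_feasible STOP_of_HPP.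
Proof.
case=> r [Hr r_full]; exists [:: r]; split=> /= [|r'|v _|v].
- by rewrite card_unit.
- rewrite inE => /eqP->; split=> //.
  by rewrite /route_time big1.
- by rewrite r_full.
- by rewrite inE.
Qed.

End Complete.

(** * From feasible solutions back to Hamiltonian paths *)

Variable R : realType.

Definition HPP_of_STOP (I : STOP_instance R) : HPP_instance :=
  MkHPP (@sarc R I) (ss I) (st I).

(* One [Limit] in total excludes foreign symbols from [w]; erasing all symbols
   foreign to HPP words then gives [w] back, and the absence of [Profitable]
   forces every vertex other than the terminals to be mandatory. *)
Lemma reduction_sound (I : STOP_instance R) w : STOP_encodes I (reduction w) ->
  [/\ w = HPP_word (HPP_of_STOP I), profitable I = set0 & #|fleet I| = 1].
Proof.
case=> d [T [_ _]]; rewrite /transduce /reduction_final => E.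
set g := digraph_word _ _ _ in E.
have g_bits n (P : pred symbol) : (forall b, P (Bit b)) -> all P (nat_word n).
  by move=> Pb; apply: sub_all (all_nat_word n) => -[].
have gP (P : pred symbol) : (forall b, P (Bit b)) ->
    all P [:: Slash; Row; NoArc; Arc; Origin; Destination; Mandatory; Profitable] ->
    all P g.
  move=> Pb /and5P[P1 P2 P3 P4] /and5P[P5 P6 P7 P8 _].
  apply: all_digraph_word => // [v|v u]; last by rewrite all_cat /= P1 !g_bits.
  by rewrite !all_cat !all_mark //= ?P5 ?P6 ?P7 ?P8 ?g_bits.
have notin (a : symbol) s (P : pred symbol) : ~~ P a -> all P s -> a \notin s.
  by move=> Pa /allP Ps; apply: contra Pa => /Ps.
(* [Fleet] occurs in neither graph part and [Limit] in no numeral, so cutting there identifies the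
   graph parts, then the fleet numerals. *)
have [||Eg /cat_cons_inj[||En _]] := cat_cons_inj _ _ E.
- apply: (notin _ _ (fun x => if x is Fleet then false else true)) => //.
  by apply: all_graph_image => // -[].
- by apply: (notin _ _ (fun x => if x is Fleet then false else true)) => //; apply: gP.
- by apply: (notin _ _ is_bit) => //; apply: all_nat_word.
- by apply: (notin _ _ is_bit) => //; apply: all_nat_word.
have gL : Limit \notin g.
  by apply: (notin _ _ (fun x => if x is Limit then false else true)) => //; apply: gP.
have wP : all is_hpp_symbol w by apply: (@graph_image_hpp_symbols false); rewrite Eg.
split; last exact/nat_word_eq1/esym.
- rewrite -(filter_graph_image false wP) Eg filter_digraph_word //.
  have bits n : filter is_hpp_symbol (nat_word n) = [::].
    apply/eqP; rewrite -(negbK (_ == _)) -has_filter -all_predC.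
    by apply: g_bits.
  apply: eq_digraph_word => [v|v u]; last by rewrite filter_cat /= !bits.
  rewrite !filter_cat !filter_mark /= bits.
  by rewrite /mark !if_same !cats0.
apply/setP=> v; rewrite in_set0; apply: contraTF isT => vP.
have : Profitable \notin graph_image false w.
  apply: (notin _ _ (fun x => if x is Profitable then false else true)) => //.
  by apply: all_graph_image => // -[].
rewrite Eg (@mem_digraph_word _ _ _ _ _ v) // vP !mem_cat inE eqxx.
by rewrite !orbT.
Qed.

(** A third vertex must be mandatory, so the single vehicle is used; its route contains all
    mandatory vertices and both terminals. *)
Lemma feasible_hamiltonian (I : STOP_instance R) :
    profitable I = set0 -> #|fleet I| = 1 -> 2 < #|sN I| -> is_feasible I ->
  has_hamiltonian_path (HPP_of_STOP I).
Proof.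
move=> P0 F1 N3 [rs [rs_size rs_route rs_mand _]].
have mandE v : (v \in mandatory I) || (v == ss I) || (v == st I).
  have /setP/(_ v) := vertices_cover I.
  by rewrite P0 setU0 !inE orbA.
have [v0 v0_mand] : exists v, v \in mandatory I.
  apply/set0Pn; apply: contraTneq N3 => M0.
  rewrite -leqNgt -cardsT -(vertices_cover I) M0 P0 !set0U.
  by rewrite cards2; case: eqP.
case: rs rs_size rs_route rs_mand => [|r [|r' rs]] /=; rewrite ?F1 //.
  by move=> _ _ /(_ _ v0_mand).
move=> _ /(_ r (mem_head _ _))[r_path _] rs_mand; exists r; split=> //= v.
case/orP: (mandE v) => [/orP[/rs_mand|/eqP->]|/eqP->]; first by case: (v \in r).
  by case: r r_path {rs_mand} => //= z q /and4P[/eqP-> _ _ _]; rewrite inE eqxx.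
case: r r_path {rs_mand} => //= z q /and4P[_ _ /eqP<- _]; exact: mem_last.
Qed.

(** If the ends coincide, a path without repetition is a single vertex and cannot cover two. *)
Lemma hamiltonian_neq (I : HPP_instance) :
  1 < #|hN I| -> has_hamiltonian_path I -> hs I != ht I.
Proof.
move=> N2 [[|z q] [//= /and4P[/eqP zs _ /eqP zt zq] r_full]].
apply: contraTneq N2 => st; rewrite -leqNgt.
have q0 : q = [::].
  case: q zt zq {r_full} => //= u q qt /andP[].
  by rewrite zs st -qt mem_last.
by rewrite -(card1 z); apply/subset_leq_card/subsetP => v _; have := r_full v; rewrite q0 !inE.
Qed.

(** The positive answer for the table: with two terminals only, using no vehicle is feasible. *)
Lemma D_FSTOP_nonempty : exists w, @D_FSTOP R w.
Proof.
pose I := @MkHPP bool (fun _ _ => false) false true.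
exists (reduction (HPP_word I)), (@STOP_of_HPP I isT R).
split; first exact: STOP_of_HPP_encodes.
by exists [::]; split=> // v; rewrite !inE; case: v.
Qed.

(** The negative answer for the table: every encoding contains [Fleet]. *)
Lemma D_FSTOP_nil : ~ @D_FSTOP R [::].
Proof. by case=> I [[d [T [_ _]]] /esym/eqP]; rewrite -size_eq0 size_cat addnS. Qed.

Lemma reductionP w : 10 < size w -> HPP w <-> D_FSTOP R (reduction w).
Proof.
move=> w_long; have N3 I : w = HPP_word I -> 2 < #|hN I|.
  (* With at most two vertices the word would have length at most 2 * (2 + 3) = 10. *)
  move=> wE; have := leq_trans w_long; rewrite wE => /(_ _ (size_HPP_word I)); nia.
split=> [[I [wE Iham]]|[I [Iw Ifeas]]].
  have neq_st := hamiltonian_neq (ltnW (N3 I wE)) Iham.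
  exists (STOP_of_HPP neq_st R); split; last exact: STOP_of_HPP_feasible.
  by rewrite wE; apply: STOP_of_HPP_encodes.
have [wE P0 F1] := reduction_sound Iw.
exists (HPP_of_STOP I); split=> //.
exact: feasible_hamiltonian P0 F1 (N3 _ wE) Ifeas.
Qed.

End Reduction.

Theorem theorem1 (R : realType) :
  poly_reducible HPP (@D_FSTOP R).
Proof.
have [yes yesP] := D_FSTOP_nonempty R.
eexists; split.
  (* The table is hardwired for the finitely many words of length at most 10, so its entries may
     come from a classical decision of [HPP]. *)
  exact: (patched_transduce_poly_time reduction_next reduction_out
    reduction_final false 10 (fun w => if `[< HPP w >] then yes else [::])).
move=> w /=; case: leqP => [_|w_long]; last exact: reductionP.
by case: asboolP => // nH; split=> // /D_FSTOP_nil.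
Qed.
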